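(* Let $k>2$ be an integer. Then there are only finitely many positive integers $n$ such that $p=kn+1$ is a strong representative of order $n$.
   Context: A strong representative of order $n$ is a prime $p$ of the form $kn+1$, $k$ a positive integer, such that $1^k,2^k,\dots,n^k$ are pairwise distinct modulo $p$. *)

(* Defs.v *)
From mathcomp Require Import all_boot.

Set Implicit Arguments.
Unset Strict Implicit.
Unset Printing Implicit Defensive.

Definition strong_representative (n p : nat) : Prop :=
  prime p /\
  exists k : nat,
    [/\ 0 < k, p = k * n + 1 &
        forall i j : nat, 1 <= i <= n -> 1 <= j <= n ->
          i ^ k = j ^ k %[mod p] -> i = j].

(* Main.v *)
Require Import Defs.
From mathcomp Require Import all_boot.
From mathcomp Require Import classical_sets cardinality.
From mathcomp Require Import all_algebra finfield zify ring.

Import GRing.Theory.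

Local Open Scope classical_set_scope.

(** Why it holds.  Let [p = k * n + 1] be prime.  Two elements of [1, n] have
    the same [k]-th power modulo [p] as soon as their quotient is a nontrivial
    [k]-th root of unity, so it suffices to write some such root as [x / y] with
    [1 <= x, y <= n].

    As [k > 2], there is a root of unity [h] of order dividing [k] other than
    [1] and [-1] ([exists_root_of_unity]).  Thue's pigeonhole argument ([thue])
    writes [h] as [a / b] or [- a / b] with [1 <= a, b <= sqrt p], and [sqrt p]
    is below [n] once [n > k].  A plus sign, or an even [k], finishes the proof.

    If the sign is minus and [k] is odd, take [a] and [b] coprime.  A point on
    the line [b * x + a * y = p] satisfies [x / y = - a / b = h], so the question
    is whether that line has an integer point in the square [1, n]^2.  Consecutive
    integer points differ by [(a, - b)]; the line cuts the square in a long enough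
    segment when [a + b > k] ([line_meets_square]), because [p] is about [k * n]
    and so the corner [(n, n)] is then well beyond the line.  If instead
    [a + b <= k], then [p] divides [a ^ k + b ^ k], which is positive and at most
    [2 * k ^ k]; this bounds [n]. *)

Lemma natr_Fp_eq (p i j : nat) : prime p ->
  i%:R%R = j%:R%R :> 'F_p -> i = j %[mod p].
Proof.
by move=> p_pr e; rewrite -!(val_Fp_nat p_pr) e.
Qed.

Lemma natr_Fp_eq0 (p i : nat) : prime p ->
  (i%:R%R == 0%R :> 'F_p) = (p %| i).
Proof.
by move=> p_pr; rewrite -(inj_eq val_inj) /= (val_Fp_nat p_pr).
Qed.

(** By Fermat, [z ^ n] is a [k]-th root of unity for every nonzero [z].  If all
    of these squared to 1, the polynomial [X^(2n+1) - X] would have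
    [p = k * n + 1] roots, more than its degree. *)
Lemma exists_root_of_unity (k n p : nat) : 2 < k -> 0 < n -> prime p ->
  p = k * n + 1 -> exists h : 'F_p, (h ^+ k = 1 /\ h ^+ 2 != 1)%R.
Proof.
move=> hk n0 p_pr def_p.
pose q : {poly 'F_p} := ('X^((n * 2).+1)%N - 'X)%R.
have size_q : size q = (n * 2).+2.
  by rewrite size_polyDl size_polyXn // size_polyN size_polyX; lia.
have [/forallP roots | /forallPn[z nz]] := boolP [forall z : 'F_p, root q z].
  have := max_poly_roots (rs := enum 'F_p) (p := q).
  rewrite -size_poly_eq0 size_q enum_uniq -cardE (card_Fp p_pr) => /(_ isT).
  have -> : all (root q) (enum 'F_p) by apply/allP => z _; exact: roots.
  by move=> /(_ isT isT); nia.
exists (z ^+ n)%R; move: nz; rewrite rootE /q !hornerE exprSr exprM.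
have [-> | z0] := eqVneq z 0%R; first by rewrite mulr0 subr0 eqxx.
move=> nz; split; last first.
  by apply: contraNneq nz => ->; rewrite mul1r subrr.
rewrite -exprM mulnC; apply: (mulIf z0); rewrite -exprSr mul1r.
have -> : (k * n).+1 = p by lia.
by rewrite -[X in (z ^+ X)%R](card_Fp p_pr) expf_card.
Qed.

Lemma exists_sqrt (p : nat) : exists s, s * s <= p < s.+1 * s.+1.
Proof.
elim: p => [|p [s hs]]; first by exists 0.
by have [hlt | hge] := ltnP p.+1 (s.+1 * s.+1); [exists s | exists s.+1]; nia.
Qed.

(** Thue's lemma: the [(s+1)^2 > p] values [x - h * y] with [0 <= x, y <= s]
    collide, and the difference of two colliding pairs is the vector sought.
    Taking absolute values of its coordinates is what loses the sign. *)
Lemma thue (p : nat) (h : 'F_p) : prime p -> h != 0%R ->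
  exists a b : nat, [/\ 0 < a, 0 < b, a * a <= p, b * b <= p &
    (a%:R = h * b%:R \/ a%:R = - (h * b%:R))%R].
Proof.
move=> p_pr h0; have [s /andP[s_le s_gt]] := exists_sqrt p.
have p_gt1 := prime_gt1 p_pr.
pose f (u : 'I_s.+1 * 'I_s.+1) : 'F_p := (u.1%:R - h * u.2%:R)%R.
have /injectivePn[u [v uDv fuv]] : ~~ injectiveb f.
  apply/negP => /injectiveP /leq_card.
  by rewrite card_prod !card_ord (Fp_cast p_pr) leqNgt s_gt.
pose d (i j : nat) := (i - j) + (j - i).
have dP (i j : nat) : ((d i j)%:R = i%:R - j%:R :> 'F_p \/
                       (d i j)%:R = - (i%:R - j%:R) :> 'F_p)%R.
  rewrite /d; case: (leqP i j) => [le_ij | /ltnW le_ij].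
    have /eqP -> : i - j == 0 by lia.
    by right; rewrite add0n natrB // opprB.
  have /eqP -> : j - i == 0 by lia.
  by left; rewrite addn0 natrB.
have rel : (u.1%:R - v.1%:R = h * (u.2%:R - v.2%:R))%R.
  apply/eqP; rewrite -subr_eq0; move/eqP: fuv; rewrite -subr_eq0 /f.
  by move=> /eqP <-; apply/eqP; ring.
have relD : ((d u.1 v.1)%:R = h * (d u.2 v.2)%:R \/
             (d u.1 v.1)%:R = - (h * (d u.2 v.2)%:R))%R.
  by case: (dP u.1 v.1) => ->; case: (dP u.2 v.2) => ->; rewrite rel
        ?mulrN ?opprK; [left | right | right | left].
have lt_p (i j : 'I_s.+1) : d i j < p.
  by rewrite /d; have := ltn_ord i; have := ltn_ord j; nia.
have d_small (i j : 'I_s.+1) : d i j * d i j <= p.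
  have : d i j <= s by rewrite /d; have := ltn_ord i; have := ltn_ord j; lia.
  by nia.
have d_eq0 (i j : 'I_s.+1) : (d i j)%:R%R = 0%R :> 'F_p -> i = j.
  move/eqP; rewrite natr_Fp_eq0 // => dv; apply: val_inj => /=.
  have := lt_p i j; have [|/dvdn_leq] := posnP (d i j); first by rewrite /d; lia.
  by move=> /(_ _ dv); lia.
have both : u.1 = v.1 <-> u.2 = v.2.
  split=> e.
    apply: d_eq0; have d0 : d u.1 v.1 = 0 by rewrite e /d subnn.
    apply/eqP; rewrite -(inj_eq (mulfI h0)) mulr0.
    by case: relD => /eqP; rewrite d0 eq_sym ?oppr_eq0.
  apply: d_eq0; have d0 : d u.2 v.2 = 0 by rewrite e /d subnn.
  by case: relD => ->; rewrite d0 mulr0 ?oppr0.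
have d_gt0 (i j : 'I_s.+1) : i <> j -> 0 < d i j.
  move=> ij; rewrite lt0n; apply/eqP => dij; apply: ij; apply: val_inj.
  by move: dij; rewrite /d /=; lia.
have uDv2 : u.2 <> v.2.
  move=> e2; move/eqP: uDv; apply; have e1 := both.2 e2.
  by rewrite [u]surjective_pairing [v]surjective_pairing e1 e2.
exists (d u.1 v.1), (d u.2 v.2); split=> //; apply: d_gt0 => // e.
by apply: uDv2; apply/both.
Qed.

(** Solving [b * x = p] modulo [a] with [1 <= x <= a] leaves [p - b * x]
    positive, as [p] exceeds [a * b]. *)
Lemma positive_combination (a b p : nat) : 0 < a -> 0 < b -> coprime a b ->
  a * b < p -> exists x y, [/\ 0 < x, x <= a, 0 < y & b * x + a * y = p].
Proof.
move=> a0 b0 co_ab ab_p.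
have [w hw] : exists w, b * w = p %[mod a].
  have /dvdnP[w ew] : b %| chinese a b p 0.
    by rewrite /dvdn (chinese_modr co_ab) mod0n.
  by exists w; rewrite mulnC -ew (chinese_modl co_ab).
pose x := if w %% a == 0 then a else w %% a.
have x_gt0 : 0 < x by rewrite /x; case: ifP => // /negbT; rewrite lt0n.
have x_le : x <= a.
  by rewrite /x; case: ifP => // _; rewrite ltnW // ltn_pmod.
have hx : b * x = p %[mod a].
  rewrite -hw /x; case: ifP => [/eqP w0 | _]; last by rewrite modnMmr.
  by rewrite modnMl -modnMmr w0 muln0 mod0n.
have lt_p : b * x < p by nia.
have /dvdnP[y ey] : a %| p - b * x by rewrite -eqn_mod_dvd 1?ltnW //; apply/eqP.
exists x, y; split=> //; last by lia.
by case: y ey => //; lia.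
Qed.

(** Start from a point of the line in the open quadrant with [x <= n] and, as
    long as [y] exceeds [n], step by [(a, - b)].  The step stays within
    [x <= n], for otherwise [x > n - a] and [y > n], which puts the point beyond
    the line. *)
Lemma line_meets_square (a b n p : nat) : 0 < a <= n -> 0 < b <= n ->
  coprime a b -> a * b < p -> p + a * b < (a + b) * n.+1 ->
  exists x y, [/\ 1 <= x <= n, 1 <= y <= n & b * x + a * y = p].
Proof.
move=> /andP[a0 a_n] /andP[b0 b_n] co_ab ab_p p_lt.
have [x [y [x0 x_a y0 exy]]] := positive_combination a b p a0 b0 co_ab ab_p.
have {x_a} x_n := leq_trans x_a a_n.
have [m] := ubnP y; elim: m => // m IHm in x y x0 x_n y0 exy *.
move=> y_m; have [y_n | n_y] := leqP y n.
  by exists x, y; rewrite x0 x_n y0 y_n.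
apply: (IHm (x + a) (y - b)); [lia | | lia | nia | lia].
by rewrite leqNgt; apply/negP => x_a; nia.
Qed.

(** Either [a + b >= 2 * k], and the left side is about at most
    [2 * k * n], or [a * b] is below [k ^ 2], which [n] absorbs. *)
Lemma corner_beyond_line (a b k n : nat) : 1 < k -> k * k <= n ->
  k < a + b -> a * b < k * n + 1 ->
  k * n + 1 + a * b < (a + b) * n.+1.
Proof.
move=> k1 n_ge k_ab ab_lt; have [ge | lt] := leqP (2 * k) (a + b); first by nia.
have ab_le : a * b <= k * k.
  have := (nat_AGM2 a b).1; rewrite -mulnn.
  have : (a + b) * (a + b) <= (2 * k) * (2 * k) by rewrite leq_mul // ltnW.
  by lia.
have : k.+1 * n.+1 <= (a + b) * n.+1 by rewrite leq_mul2r k_ab orbT.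
by lia.
Qed.

Lemma two_small_same_power (k n : nat) : 2 < k -> 2 * k ^ k <= n ->
  prime (k * n + 1) ->
  exists i j, [/\ 1 <= i <= n, 1 <= j <= n,
                  i ^ k = j ^ k %[mod k * n + 1] & i <> j].
Proof.
move=> hk n_ge; set p := k * n + 1 => p_pr.
have k2_le : k * k <= k ^ k.
  by rewrite -[k * k]/(k ^ 2) leq_pexp2l //; lia.
have n0 : 0 < n by nia.
have [h [hk1 h2]] := exists_root_of_unity k n p hk n0 p_pr erefl.
have h0 : h != 0%R.
  apply/negP => /eqP h0; move/eqP: hk1.
  by rewrite h0 expr0n; have -> : (k == 0) = false by lia.
have h1 : h <> 1%R by move=> e; move: h2; rewrite e expr1n eqxx.
have hN1 : h <> (-1)%R by move=> e; move: h2; rewrite e sqrrN expr1n eqxx.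
have natr_neq0 i : 0 < i <= n -> (i%:R != 0 :> 'F_p)%R.
  move=> /andP[i0 i_n]; rewrite natr_Fp_eq0 //; apply/negP => /dvdn_leq.
  by move=> /(_ i0); rewrite /p; nia.
have same x y : 0 < x <= n -> 0 < y <= n -> (x%:R = h * y%:R :> 'F_p)%R ->
    exists i j, [/\ 1 <= i <= n, 1 <= j <= n, i ^ k = j ^ k %[mod p] & i <> j].
  move=> hx hy exy; exists x, y; split=> //.
    by apply: natr_Fp_eq => //; rewrite !natrX exy exprMn hk1 mul1r.
  move=> e; apply: h1; apply: (mulIf (natr_neq0 y hy)).
  by rewrite -exy e mul1r.
have [a' [b' [a'0 b'0 a'_p b'_p rel]]] := thue p h p_pr h0.
have small c : c * c <= p -> c <= n by rewrite /p; nia.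
have a'_n := small _ a'_p; have b'_n := small _ b'_p.
have a'Nb' : a' <> b'.
  move=> e; have b'N0 : (b'%:R != 0 :> 'F_p)%R by apply: natr_neq0; lia.
  case: rel; rewrite e => eh; [apply: h1 | apply: hN1]; apply: (mulIf b'N0).
    by rewrite -eh mul1r.
  by rewrite mulN1r [in RHS]eh opprK.
case: rel => [rel | rel]; first by apply: (same a' b'); rewrite ?a'0 ?b'0.
have [k_odd | k_even] := boolP (odd k); last first.
  exists a', b'; rewrite a'0 b'0; split=> //; apply: natr_Fp_eq => //.
  rewrite !natrX rel exprNn exprMn hk1 mul1r -signr_odd (negbTE k_even).
  by rewrite expr0 mul1r.
pose g := gcdn a' b'.
have g0 : 0 < g by rewrite gcdn_gt0 a'0.
have /dvdnP[a ea] := dvdn_gcdl a' b'; have /dvdnP[b eb] := dvdn_gcdr a' b'.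
rewrite -/g in ea eb.
have co_ab : coprime a b.
  by rewrite /coprime -(eqn_pmul2r g0) muln_gcdl -ea -eb mul1n.
have a0 : 0 < a by nia.
have b0 : 0 < b by nia.
have a_le : a <= a' by nia.
have b_le : b <= b' by nia.
(* [a' <> b'] makes this strict even when both are as large as [sqrt p]. *)
have ab_p : a * b < p.
  have : a' * b' < p by nia.
  by apply: leq_ltn_trans; rewrite leq_mul.
have g_n : 0 < g <= n by rewrite g0; nia.
have {}rel : (a%:R = - (h * b%:R) :> 'F_p)%R.
  apply: (mulIf (natr_neq0 g g_n)); rewrite -natrM -ea rel {1}eb natrM; ring.
have [ab_k | k_ab] := leqP (a + b) k.
  have : p %| a ^ k + b ^ k.
    rewrite -(natr_Fp_eq0 _ _ p_pr) natrD !natrX rel exprNn exprMn hk1.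
    by rewrite -signr_odd k_odd expr1 mul1r mulN1r addNr.
  have ak : a ^ k <= k ^ k by rewrite leq_exp2r; lia.
  have bk : b ^ k <= k ^ k by rewrite leq_exp2r; lia.
  have ak0 : 0 < a ^ k by rewrite expn_gt0 a0.
  by move/dvdn_leq; rewrite /p; nia.
have a_n : 0 < a <= n by rewrite a0 (leq_trans a_le).
have b_n : 0 < b <= n by rewrite b0 (leq_trans b_le).
have p_lt : p + a * b < (a + b) * n.+1.
  by apply: corner_beyond_line => //; lia.
have [x [y [hx hy exy]]] := line_meets_square a b n p a_n b_n co_ab ab_p p_lt.
apply: (same x y hx hy); apply: (mulfI (natr_neq0 b b_n)).
have : (b%:R * x%:R + a%:R * y%:R = 0 :> 'F_p)%R.
  by rewrite -!natrM -natrD exy; apply/eqP; rewrite natr_Fp_eq0.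
by rewrite rel => /eqP; rewrite mulNr subr_eq0 => /eqP ->; ring.
Qed.

Theorem theorem1p10 (k : nat) (hk : 2 < k) :
  finite_set [set n : nat | 0 < n /\ strong_representative n (k * n + 1)].
Proof.
apply: (sub_finite_set _ (finite_II (2 * k ^ k))) => n /= [n0 [p_pr]].
move=> [k' [_ ek inj]]; have {ek} ek : k' = k by nia.
rewrite {k'}ek in inj.
rewrite ltnNge; apply/negP => n_ge.
have [i [j [hi hj eij]]] := two_small_same_power k n hk n_ge p_pr.
by apply; apply: inj.
Qed.
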